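(* For every continuum $X$ and every $x \in X$, the set $B(x)$ of all points of $X$ blocked by $\{x\}$ is connected.
   Context: A continuum is a nonempty compact connected metric space. $2^X$ is the space of all nonempty closed subsets of $X$ with the Hausdorff metric. For $A, B \in 2^X$, $B$ does not block $A$ if there is a continuous map $\gamma:[0,1]\to 2^X$ with $\gamma(0)=A$, $\gamma(1)=X$ and $\gamma(t)\cap B=\emptyset$ for all $t<1$; otherwise $B$ blocks $A$. For $a \in X$, $B(a)=\{y\in X : \{a\}\text{ blocks }\{y\}\}$. *)

(* Defs.v *)
From HB Require Import structures.
From mathcomp Require Import all_boot all_order all_algebra.
From mathcomp Require Import all_classical all_reals all_analysis.

Set Implicit Arguments.
Unset Strict Implicit.
Unset Printing Implicit Defensive.

Import Order.TTheory GRing.Theory Num.Theory.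
Import numFieldNormedType.Exports.

Local Open Scope classical_set_scope.
Local Open Scope ring_scope.

HB.mixin Record isContinuum (R : realType) X & Metric R X := {
  continuum_nonempty : [set: X] !=set0 ;
  continuum_compact : compact [set: X] ;
  continuum_connected : connected [set: X]
}.

#[short(type="continuumType")]
HB.structure Definition Continuum (R : realType) :=
  { X of Metric R X & isContinuum R X }.

Section point_set_distance.
Context {R : realType} {X : metricType R}.
Implicit Types (a b x : X) (A B C : set X).

Definition set_dist a B : R := inf [set mdist a b | b in B].

(* The supremum is that of a bounded set as soon as X is compact; otherwise
   [sup] may take its default value. *)
Definition hausdorff_excess A B : R := sup [set set_dist a B | a in A].

Definition hausdorff_dist A B : R :=
  Num.max (hausdorff_excess A B) (hausdorff_excess B A).

Lemma has_lbound_set_dist a B : has_lbound [set mdist a b | b in B].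
Proof. by exists 0 => _ [b _ <-]; exact: mdist_ge0. Qed.

Lemma set_dist_ge0 a B : B !=set0 -> 0 <= set_dist a B.
Proof.
move=> [b Bb]; apply: lb_le_inf; first by exists (mdist a b), b.
by move=> _ [c _ <-]; exact: mdist_ge0.
Qed.

Lemma set_dist_le a b B : B b -> set_dist a B <= mdist a b.
Proof. by move=> Bb; apply: ge_inf (has_lbound_set_dist a B) _ _; exists b. Qed.

Lemma set_dist_adherent a B (e : R) : B !=set0 -> 0 < e ->
  exists2 b, B b & mdist a b < set_dist a B + e.
Proof.
move=> [b0 Bb0] e0.
have [|_ [b Bb <-] abe] := @inf_adherent _ [set mdist a b | b in B] _ e0.
  by split; [exists (mdist a b0), b0 | exact: has_lbound_set_dist].
by exists b.
Qed.

Lemma set_dist_triangle a b C : C !=set0 ->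
  set_dist a C <= mdist a b + set_dist b C.
Proof.
move=> C0; rewrite -lerBlDl; apply: lb_le_inf.
  by have [c Cc] := C0; exists (mdist b c), c.
move=> _ [c Cc <-]; rewrite lerBlDl.
exact: le_trans (set_dist_le a Cc) (metric_triangle _ _ _).
Qed.

Lemma set_dist_le0 a B : closed B -> B !=set0 -> set_dist a B <= 0 -> B a.
Proof.
move=> cB B0 aB0; apply: cB => U /nbhs_ballP[e /= e0 aeU].
have [b Bb abe] := set_dist_adherent a B0 e0.
exists b; split => //; apply: aeU; rewrite ballEmdist /=.
by apply: lt_le_trans abe _; rewrite gerDr.
Qed.

End point_set_distance.

Section continuum_hausdorff.
Context {R : realType} {X : continuumType R}.
Implicit Types (a b x : X) (A B C : set X).

Lemma continuum_mdist_bounded : exists M : R, forall a b, mdist a b <= M.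
Proof.
have [x _] := @continuum_nonempty R X.
have /compact_near_coveringP cX := @continuum_compact R X.
have [|N _ /(_ N (leqnn N)) NX] :=
    cX nat \oo (fun n a => mdist x a <= n%:R) _.
  move=> a _; exists (ball a 1, [set n | (Num.truncn (mdist x a)).+2 <= n]%N).
    by split; [exact: nbhsx_ballx | exists (Num.truncn (mdist x a)).+2].
  move=> [b n] [/= + an]; rewrite ballEmdist /= => ab1.
  apply: le_trans (metric_triangle x a b) _.
  apply: (@le_trans _ _ (Num.truncn (mdist x a)).+2%:R); last by rewrite ler_nat.
  by rewrite -[leRHS]natr1 lerD // ltW // truncnS_gt.
have xN a : mdist x a <= N%:R by exact: NX.
exists (N%:R + N%:R) => a b.
by apply: le_trans (metric_triangle a x b) _; rewrite lerD // metric_sym.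
Qed.

Lemma has_ubound_hausdorff_excess A B : B !=set0 ->
  has_ubound [set set_dist a B | a in A].
Proof.
move=> [b Bb]; have [M dM] := continuum_mdist_bounded.
by exists M => _ [a _ <-]; exact: le_trans (set_dist_le a Bb) (dM _ _).
Qed.

Lemma set_dist_excess A B a : B !=set0 -> A a ->
  set_dist a B <= hausdorff_excess A B.
Proof.
move=> B0 Aa; apply: (ub_le_sup (has_ubound_hausdorff_excess A B0)).
by exists a.
Qed.

Lemma hausdorff_excess_le A B (r : R) : A !=set0 ->
  (forall a, A a -> set_dist a B <= r) -> hausdorff_excess A B <= r.
Proof.
move=> [a Aa] ABr; apply: ge_sup; first by exists (set_dist a B), a.
by move=> _ [b Ab <-]; exact: ABr.
Qed.

Lemma hausdorff_excess_triangle A B C : A !=set0 -> B !=set0 -> C !=set0 ->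
  hausdorff_excess A C <= hausdorff_excess A B + hausdorff_excess B C.
Proof.
move=> A0 B0 C0; apply: hausdorff_excess_le => // a Aa.
apply/ler_addgt0Pr => e e0.
have [b Bb abe] := set_dist_adherent a B0 e0.
apply: le_trans (set_dist_triangle a b C0) _.
rewrite addrAC lerD ?set_dist_excess //.
by apply: le_trans (ltW abe) _; rewrite lerD2r set_dist_excess.
Qed.

Lemma hausdorff_distxx A : A !=set0 -> hausdorff_dist A A = 0.
Proof.
move=> A0; rewrite /hausdorff_dist maxxx; apply/eqP; rewrite eq_le.
apply/andP; split.
  apply: hausdorff_excess_le => // a Aa.
  by rewrite -(mdistxx a); exact: set_dist_le.
by have [a Aa] := A0; apply: le_trans (set_dist_ge0 a A0) (set_dist_excess _ _).
Qed.

Lemma hausdorff_distC A B : hausdorff_dist A B = hausdorff_dist B A.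
Proof. exact: maxC. Qed.

Lemma hausdorff_dist_triangle B A C : A !=set0 -> B !=set0 -> C !=set0 ->
  hausdorff_dist A C <= hausdorff_dist A B + hausdorff_dist B C.
Proof.
move=> A0 B0 C0; rewrite /hausdorff_dist ge_max; apply/andP; split.
  apply: le_trans (hausdorff_excess_triangle A0 B0 C0) _.
  by rewrite lerD // le_max lexx.
apply: le_trans (hausdorff_excess_triangle C0 B0 A0) _.
by rewrite addrC lerD // le_max lexx orbT.
Qed.

Lemma hausdorff_dist_sub A B : closed B -> B !=set0 ->
  hausdorff_dist A B = 0 -> A `<=` B.
Proof.
move=> cB B0 AB0 a Aa; apply: set_dist_le0 => //; rewrite -AB0.
by apply: le_trans (set_dist_excess B0 Aa) _; rewrite le_max lexx.
Qed.

End continuum_hausdorff.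

Record hyperspace (R : realType) (X : continuumType R) := Hyperspace {
  hyperspace_set :> set X ;
  hyperspace_closed : closed hyperspace_set ;
  hyperspace_nonempty : hyperspace_set !=set0
}.

Section hyperspace_metric.
Context {R : realType} {X : continuumType R}.
Implicit Types A B C : hyperspace X.

Lemma hyperspace_inj A B : A = B :> set X -> A = B.
Proof.
case: A B => [A cA A0] [B cB B0] /= AB; case: _ / AB in cB B0 *.
by congr Hyperspace; exact: Prop_irrelevance.
Qed.

HB.instance Definition _ := gen_eqMixin (hyperspace X).
HB.instance Definition _ := gen_choiceMixin (hyperspace X).

Let hdist A B : R := hausdorff_dist A B.

Let hdistxx A : hdist A A = 0.
Proof. exact: hausdorff_distxx (hyperspace_nonempty A). Qed.

Let hdist_positivity A B : hdist A B = 0 -> A = B.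
Proof.
move=> AB0; apply: hyperspace_inj; apply/seteqP; split.
  apply: hausdorff_dist_sub AB0;
    [exact: hyperspace_closed | exact: hyperspace_nonempty].
rewrite /hdist hausdorff_distC in AB0.
apply: hausdorff_dist_sub AB0;
  [exact: hyperspace_closed | exact: hyperspace_nonempty].
Qed.

Let hdistC A B : hdist A B = hdist B A.
Proof. exact: hausdorff_distC. Qed.

Let hdist_triangle B A C : hdist A C <= hdist A B + hdist B C.
Proof. by apply: hausdorff_dist_triangle; exact: hyperspace_nonempty. Qed.

HB.instance Definition _ := @isMetric.Build R (hyperspace X) hdist
  hdistxx hdist_positivity hdistC hdist_triangle.

Lemma mdist_hyperspace A B : mdist A B = hausdorff_dist A B.
Proof. by []. Qed.

End hyperspace_metric.

Section blocking.
Context {R : realType} {X : continuumType R}.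
Implicit Types (a x y : X) (A B : hyperspace X).

Lemma closed_singleton x : closed [set x].
Proof.
apply: accessible_closed_set1; exact/hausdorff_accessible/metric_hausdorff.
Qed.

Lemma singleton_nonempty x : [set x] !=set0.
Proof. by exists x. Qed.

Definition hsingleton x : hyperspace X :=
  Hyperspace (@closed_singleton x) (singleton_nonempty x).

Definition hyperspaceT : hyperspace X :=
  Hyperspace closedT (@continuum_nonempty R X).

Definition does_not_block B A :=
  exists gamma : R -> hyperspace X,
    [/\ {within `[0, 1], continuous gamma},
        gamma 0 = A,
        gamma 1 = hyperspaceT &
        forall t : R, 0 <= t < 1 -> gamma t `&` B = set0].

Definition blocks B A := ~ does_not_block B A.

Definition blocked_points a : set X :=
  [set y | blocks (hsingleton a) (hsingleton y)].

End blocking.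

(* Main.v *)
(** Let [y <> x] be blocked by [{x}], and let [L] be a maximal chain of closed
    connected sets containing [y]. By boundary bumping [L] has no gaps, so it
    is the range of a path of the hyperspace from [{y}] to [X]: pull [L] back
    along a function that is strictly monotone on closed sets. Cutting
    [L] just before it reaches [x] gives a connected union [S] of members of
    [L] that avoid [x], and the absence of gaps puts [x] in the closure of
    [S]. If a point [z] of such a member [A] were not blocked, then neither
    would be [y]: follow [L] from [{y}] to [A], then take the union of [A]
    with the path from [{z}] to [X]. Hence [S `|` [set x]] is a connected set
    of blocked points containing both [x] and [y]. *)
From HB Require Import structures.
Require Import Defs.
From mathcomp Require Import all_boot all_order all_algebra.
From mathcomp Require Import all_classical all_reals all_analysis.
From mathcomp Require Import lra.

Set Implicit Arguments.
Unset Strict Implicit.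
Unset Printing Implicit Defensive.

Import Order.TTheory GRing.Theory Num.Theory.
Import numFieldNormedType.Exports.

Local Open Scope classical_set_scope.
Local Open Scope ring_scope.

(** * Boundary bumping in compact Hausdorff spaces *)

Section compact_hausdorff.
Context (R : realType) {T : topologicalType}.
Hypotheses (hT : hausdorff_space T) (cT : compact [set: T]).
Implicit Types (A B C E U V : set T) (D : set (set T)).

Definition directed D :=
  forall A B, D A -> D B -> exists2 C, D C & C `<=` A `&` B.

(** A point outside [U] is missed by some closed member, hence a neighbourhood of it is missed by
    all subsets of that member. Near covering along [F], the filter of small sets, makes this
    uniform. *)
Lemma bigcap_directed_sub D U : D !=set0 -> directed D -> D `<=` closed ->
  open U -> \bigcap_(A in D) A `<=` U -> exists2 A, D A & A `<=` U.
Proof.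
move=> D0 dD cD oU DU.
pose F := filter_from D (fun A => [set B | B `<=` A]).
have FF : Filter F.
  apply: filter_from_filter => // A B /dD /[apply] -[C DC].
  rewrite subsetI => -[CA CB].
  by exists C => // E EC; split; exact: subset_trans EC _.
have /compact_near_coveringP/(_ _ F (fun B x => B x -> U x) FF) := cT.
case=> [x _|A DA /(_ _ (@subset_refl _ A)) AU]; last first.
  by exists A => // x Ax; exact: AU.
have [Ux|nUx] := pselect (U x).
  exists (U, setT); last by move=> [z B] [].
  by split; [exact: open_nbhs_nbhs | exact: filterT].
have [A DA nAx] : exists2 A, D A & ~ A x.
  by apply: contrapT => nD; apply/nUx/DU => A DA; apply: contrapT => nAx;
     apply: nD; exists A.
exists (~` A, [set B | B `<=` A]); last by move=> [z B] [/= nAz BA /BA].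
split; last by exists A.
by apply: open_nbhs_nbhs; split => //; apply/closed_openC; exact: cD.
Qed.

Lemma disjoint_open_separated U V : open U -> open V -> U `&` V = set0 ->
  separated U V.
Proof.
move=> oU oV UV0; split; rewrite -subset0 => x [].
  move=> /(_ V) + Vx => /(_ (open_nbhs_nbhs (conj oV Vx))).
  by rewrite UV0 => -[].
move=> Ux /(_ U (open_nbhs_nbhs (conj oU Ux))).
by rewrite setIC UV0 => -[].
Qed.

(** By normality the two closed pieces have disjoint open neighbourhoods, and some member already
    lies in their union. *)
Lemma bigcap_directed_disconnected D : D !=set0 -> directed D ->
    D `<=` closed -> ~ connected (\bigcap_(A in D) A) ->
  exists U V A, [/\ open U, open V, U `&` V = set0, D A & A `<=` U `|` V] /\
    [/\ \bigcap_(A in D) A `&` U !=set0 & \bigcap_(A in D) A `&` V !=set0].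
Proof.
move=> D0 dD cD; set Q := \bigcap_(A in D) A.
have cQ : closed Q by exact: closed_bigI.
move=> /connectedPn[E [E0 QE [sE1 sE2]]].
have cE b : closed (E b).
  apply/closure_id/seteqP; split=> [|x Ebx]; first exact: subset_closure.
  have : Q x.
    apply: cQ; apply: closureS Ebx; rewrite QE.
    by case: b; [right|left].
  rewrite QE; case: b Ebx => Ebx [] // Ex.
    by have : set0 x by rewrite -sE2.
  by have : set0 x by rewrite -sE1.
have E12 : E false `&` E true = set0.
  by rewrite -sE1; congr (_ `&` _); exact/closure_id.
have [U [V [oU oV EU EV UV0]]] := ((@normal_openP R _).1 (compact_normal hT cT))
  _ _ (cE false) (cE true) E12.
have [|A DA AUV] := bigcap_directed_sub D0 dD cD (openU oU oV).
  by rewrite -/Q QE; exact: setUSS.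
exists U, V, A; split; first by split.
have [[x Ex] [x' Ex']] := (E0 false, E0 true).
split; [exists x|exists x']; rewrite QE; split;
  [by left|exact:EU|by right|exact: EV].
Qed.

(** A connected member inside the union of [U] and [V] lies in one of them, yet contains the
    intersection, which meets both. *)
Lemma bigcap_chain_connected D : D !=set0 -> total_on D subset ->
  D `<=` closed -> D `<=` connected -> connected (\bigcap_(A in D) A).
Proof.
move=> D0 tD clD coD; apply: contrapT => nQ.
have dD : directed D.
  move=> A B DA DB; have [AB|BA] := tD _ _ DA DB; [exists A|exists B] => //.
    by move=> x Ax; split => //; exact: AB.
  by move=> x Bx; split => //; exact: BA.
have [U [V [A [[oU oV UV0 DA AUV] [[x [Qx Ux]] [z [Qz Vz]]]]]]] :=
  bigcap_directed_disconnected D0 dD clD nQ.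
have [] := connected_subset (disjoint_open_separated oU oV UV0) AUV (coD _ DA).
  move=> /(_ z (Qz _ DA)) Uz.
  by have : set0 z by rewrite -UV0.
move=> /(_ x (Qx _ DA)) Vx.
by have : set0 x by rewrite -UV0.
Qed.

(** For closed [E], the clopen subsets of the subspace [E] around [a]; their intersection is the
    quasi-component of [a]. *)
Definition relative_clopen E a : set (set T) :=
  [set A | [/\ closed A, A a & exists2 O, open O & A = E `&` O]].

Lemma relative_clopen_directed E a : directed (relative_clopen E a).
Proof.
move=> A B [cA Aa [ O oO AO]] [cB Ba [P oP BP]]; exists (A `&` B) => //.
split; [exact: closedI | by split | exists (O `&` P); first exact: openI].
by rewrite AO BP setIACA setIid.
Qed.

Lemma relative_clopen_id E a : closed E -> E a -> relative_clopen E a E.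
Proof.
by move=> cE Ea; split => //; exists setT; [exact: openT | rewrite setIT].
Qed.

Lemma relative_clopen_closed E a : relative_clopen E a `<=` closed.
Proof. by move=> A []. Qed.

Lemma quasi_component_connected E a : closed E -> E a ->
  connected (\bigcap_(A in relative_clopen E a) A).
Proof.
move=> cE Ea; set D := relative_clopen E a; apply: contrapT => nQ.
have D0 : D !=set0 by exists E; exact: relative_clopen_id.
have [U [V [A [[oU oV UV0 [cA Aa [ O oO AO]] AUV]]]]] :=
  bigcap_directed_disconnected D0 (@relative_clopen_directed E a)
    (@relative_clopen_closed E a) nQ.
wlog Ua : U V oU oV UV0 AUV / U a.
  move=> wl; have [Ua|Va] := AUV _ Aa; first exact: wl.
  move=> [QU QV]; apply: (wl V U) => //; [by rewrite setIC|by rewrite setUC].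
move=> [_ [z [Qz Vz]]].
(* The part of [A] on the side of [a] is again relatively clopen: it is closed because it is what
   [A] leaves outside [V]. It would therefore cut off the piece in [V]. *)
have AUE : A `&` U = A `&` ~` V.
  apply/seteqP; split=> w [Aw] H; split => //.
    by move=> Vw; have : set0 w by rewrite -UV0.
  by case: (AUV _ Aw).
have /Qz[_ Uz] : D (A `&` U).
  split; [by rewrite AUE; apply: closedI => //; exact: open_closedC | by split |].
  by exists (O `&` U); [exact: openI | rewrite AO setIA].
by have : set0 z by rewrite -UV0.
Qed.

(* A form of boundary bumping: [C] is the quasi-component of a point of [A] in
   [B `&` closure U], for an open [U] containing [A] but not all of [B] in its
   closure. *)
Lemma connected_closed_between A B : A !=set0 ->
    closed A -> connected A -> closed B -> connected B -> A `<` B ->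
  exists C, [/\ closed C, connected C, A `<` C & C `<` B].
Proof.
move=> [a Aa] clA coA clB coB [AB /nonsubset[p [Bp nAp]]].
have Ap0 : A `&` [set p] = set0.
  by rewrite -subset0 => x [/[swap] -> /nAp].
have clp : closed [set p].
  exact/accessible_closed_set1/hausdorff_accessible.
have [U [V [oU oV AU /(_ p erefl) Vp UV0]]] :=
  ((@normal_openP R _).1 (compact_normal hT cT)) _ _ clA clp Ap0.
have [_ clUV] := disjoint_open_separated oV oU (etrans (setIC _ _) UV0).
have nclUp : ~ closure U p by move=> Up; have : set0 p by rewrite -clUV.
have UcU : U `<=` closure U := @subset_closure _ U.
pose E := B `&` closure U.
have clE : closed E by apply: closedI => //; exact: closed_closure.
have AE : A `<=` E by move=> x Ax; split; [exact: AB | exact/UcU/AU].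
pose Q := \bigcap_(C in relative_clopen E a) C.
have RE : relative_clopen E a E.
  exact: relative_clopen_id clE (AE _ Aa).
have clQ : closed Q by apply: closed_bigI => C [].
(* A relatively clopen [C] cuts the connected [A] in a clopen set containing [a], hence in all of
   [A]. *)
have AQ : A `<=` Q.
  move=> x Ax C [clC Ca [ O oO CO]].
  suff ACA : A `&` C = A by move: Ax; rewrite -ACA => -[].
  apply: coA; [by exists a | exists O => // | by exists C].
  by rewrite CO setIA (setIidl AE).
have QE : Q `<=` E by move=> x; exact.
exists Q; split => //; first exact: quasi_component_connected clE (AE _ Aa).
(* If [Q] were [A], compactness would put some relatively clopen [C] inside [U]. Such a [C] is open
   in [B], not merely in [E], so it is all of [B]; but [p] is outside [U]. *)
- split=> // QA; have {QA} AQE : A = Q by apply/seteqP.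
  have [|C RC CU] := bigcap_directed_sub (ex_intro _ E RE)
    (@relative_clopen_directed E a) (@relative_clopen_closed E a) oU.
    by rewrite -/Q -AQE.
  have [clC Ca [ O oO CO]] := RC.
  suff CB : C = B by apply/nclUp/UcU/CU; rewrite CB.
  apply: coB; first by exists a.
    exists (O `&` U); first exact: openI.
    apply/seteqP; split=> x.
      by move=> Cx; have Ux := CU _ Cx; move: Cx; rewrite CO => -[[]].
    by move=> [Bx [Ox Ux]]; rewrite CO; split => //; split => //; exact: UcU.
  exists C => //; apply/esym/setIidPr => x.
  by rewrite CO => -[[]].
- by split=> [x /QE[] // | /(_ p Bp)/QE[]].
Qed.

End compact_hausdorff.

(** * Strictly monotone real functions on sets *)

Section strictly_monotone.
Context {R : realType}.

Let weight (N : set nat) (n : nat) : R := (n \in N)%:R * 2^-1 ^+ n.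

Let weight_ge0 N n : 0 <= weight N n.
Proof. by rewrite mulr_ge0 // exprn_ge0. Qed.

Let is_cvg_weight N : cvgn (series (weight N)).
Proof.
apply: (series_le_cvg (v_ := geometric 1 2^-1)) => //.
- by move=> n; rewrite /= mul1r exprn_ge0.
- by move=> n; rewrite /= mul1r ler_piMl ?exprn_ge0 // lern1 leq_b1.
- by apply: is_cvg_geometric_series; rewrite ger0_norm ?invf_lt1 ?ltr1n.
Qed.

(** Take the sum of 2^-n over the elements [n]; an extra element [k] adds at least 2^-k. *)
Lemma strictly_monotone_nat : exists m : set nat -> R,
  (forall N, 0 <= m N) /\ (forall M N, M `<` N -> m M < m N).
Proof.
exists (fun N => limn (series (weight N))); split=> [N|M N [MN]].
  apply: limr_ge; first exact: is_cvg_weight.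
  by apply: nearW => n; apply: sumr_ge0 => i _; exact: weight_ge0.
move=> /nonsubset[k [Nk nMk]].
have wMN i : weight M i <= weight N i.
  rewrite ler_wpM2r ?exprn_ge0 // ler_nat.
  by have [/set_mem/MN/mem_set ->|_] := boolP (i \in M); rewrite ?leq_b1.
rewrite -subr_gt0 -limB; [|exact: is_cvg_weight|exact: is_cvg_weight].
apply: (@lt_le_trans _ _ (2^-1 ^+ k)); first by rewrite exprn_gt0.
apply: limr_ge; first by apply: is_cvgB; exact: is_cvg_weight.
near=> n; rewrite /= -[leRHS]sumrB big_mkord.
have kn : (k < n)%N by near: n; exact: nbhs_infty_gt.
rewrite (bigD1 (Ordinal kn)) //= {1 2}/weight (mem_set Nk) memNset // mul0r.
rewrite subr0 mul1r lerDl; apply: sumr_ge0 => i _.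
by rewrite subr_ge0.
Unshelve. all: by end_near. Qed.

End strictly_monotone.

Section strictly_monotone_closed.
Context {R : realType} {X : pseudoMetricType R}.

(* [compact_second_countable] requires a pointed space. *)
Definition pointed_at (x : X) : Type := X.
HB.instance Definition _ (x : X) := PseudoMetric.copy (pointed_at x) X.
HB.instance Definition _ (x : X) := isPointed.Build (pointed_at x) x.

(** Weigh the codes of the members of a countable base that meet the set. A point of [B] outside the
    closed [A] has a basic neighbourhood missing [A], which gives [B] an extra code. *)
Lemma compact_strictly_monotone (x : X) : compact [set: X] ->
  exists m : set X -> R, (forall A, 0 <= m A) /\
    (forall A B, closed A -> A `<` B -> m A < m B).
Proof.
move=> /(@compact_second_countable R (pointed_at x))[Bs].
move=> /countable_injP[f f_inj] [oBs Bs_basis].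
have [m [m0 mlt]] := @strictly_monotone_nat R.
pose hit (A : set X) := [set f U | U in [set U | Bs U /\ U `&` A !=set0]].
exists (m \o hit); split=> [A|A B cA [AB /nonsubset[z [Bz nAz]]]].
  exact: m0.
have [U [BsU Uz] UA] := Bs_basis z _ (open_nbhs_nbhs
  (conj (closed_openC cA) nAz)).
apply: mlt; split => [_ [V [BsV [w [Vw Aw]]] <-]|].
  by exists V => //; split => //; exists w; split => //; exact: AB.
have : hit B (f U) by exists U => //; split => //; exists z.
move=> /[swap] /[apply] -[V [BsV [w [Vw Aw]]]].
by move=> /(f_inj _ _ (mem_set BsV) (mem_set BsU)) VU; apply: UA Aw; rewrite -VU.
Qed.

End strictly_monotone_closed.

(** * Continuity of maps into the hyperspace *)

Lemma nonexpansive_continuous {R : realType} {X Y : metricType R} (f : X -> Y) :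
  (forall x y, mdist (f x) (f y) <= mdist x y) -> continuous f.
Proof.
move=> f_le x; apply/cvg_ballP => e e0; near=> y.
have : ball x e y by near: y; exact: nbhsx_ballx.
by rewrite !ballEmdist /=; exact/le_lt_trans/f_le.
Unshelve. all: by end_near. Qed.

Section hyperspace_continuity.
Context {R : realType} {X : continuumType R}.
Implicit Types (A B : hyperspace X) (G : R -> hyperspace X).

Lemma mdist_hyperspace_le A B (r : R) :
  (forall a, hyperspace_set A a -> set_dist a B <= r) ->
  (forall b, hyperspace_set B b -> set_dist b A <= r) -> mdist A B <= r.
Proof.
move=> ABr BAr; rewrite mdist_hyperspace ge_max; apply/andP.
by split; apply: hausdorff_excess_le => //; exact: hyperspace_nonempty.
Qed.

(** The last two hypotheses are pointwise forms of left and right continuity; compactness of [X]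
    makes them uniform in [z]. *)
Lemma monotone_hyperspace_continuous G :
  (forall s t, s <= t -> G s `<=` G t) ->
  (forall t z (e : R), hyperspace_set (G t) z -> 0 < e ->
    exists2 s, s < t & exists2 w, hyperspace_set (G s) w & mdist z w < e) ->
  (forall t z, ~ hyperspace_set (G t) z ->
    exists2 s, t < s & ~ hyperspace_set (G s) z) ->
  continuous G.
Proof.
move=> Gmono Gleft Gright t.
apply/cvg_ballP => e e0; have e20 : 0 < e / 2 by rewrite divr_gt0.
pose P s z := (hyperspace_set (G s) z -> set_dist z (G t) <= e / 2) /\
  (hyperspace_set (G t) z -> set_dist z (G s) <= e / 2).
have /compact_near_coveringP/(_ _ (nbhs t) P _) := @continuum_compact R X.
case=> [z _|d /= d0 tdP]; last first.
  exists d => // s /tdP sP; rewrite ballEmdist /=.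
  apply: (@le_lt_trans _ _ (e / 2)); last first.
    by rewrite ltr_pdivrMr // ltr_pMr // ltr1n.
  by apply: mdist_hyperspace_le => b Gb; [apply: (sP b I).2|apply: (sP b I).1].
have [Gtz|nGtz] := pselect (hyperspace_set (G t) z).
  (* By monotonicity [w] is in [G t] and in [G r] for all [r > s], so it serves both bounds; two
     errors of e / 4 add up to e / 2. *)
  have [s st [w Gsw zw]] := Gleft t z _ Gtz (divr_gt0 e20 (ltr0Sn _ 1)).
  exists (ball z (e / 2 / 2), [set r | s < r]).
    by split; [apply: nbhsx_ballx; rewrite divr_gt0 | exact: lt_nbhsr].
  move=> [z' r] [/= + sr]; rewrite ballEmdist /= => zz'.
  have z'w : mdist z' w <= e / 2.
    rewrite [leRHS]splitr (le_trans (metric_triangle z' z w)) // lerD ?ltW //.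
    by rewrite metric_sym.
  split=> _; apply: le_trans z'w; apply: set_dist_le.
  - exact: Gmono (ltW st) _ Gsw.
  - exact: Gmono (ltW sr) _ Gsw.
(* Points off [G s] are off [G t] and off [G r] for [r < s], so both halves of [P] hold
   vacuously. *)
have [s ts nGsz] := Gright t z nGtz.
exists (~` hyperspace_set (G s), [set r | r < s]).
  split; last exact: lt_nbhsl.
  apply: open_nbhs_nbhs; split => //.
  by apply: closed_openC; exact: hyperspace_closed.
move=> [z' r] [/= nGsz' rs]; split=> Gz'; exfalso; apply: nGsz'.
- exact: Gmono (ltW rs) _ Gz'.
- exact: Gmono (ltW ts) _ Gz'.
Qed.

Let setU_closed A B : closed (A `|` B).
Proof. by apply: closedU; exact: hyperspace_closed. Qed.

Let setU_nonempty A B : A `|` B !=set0.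
Proof. by have [a Aa] := hyperspace_nonempty A; exists a; left. Qed.

Definition hyperspaceU A B : hyperspace X :=
  Hyperspace (@setU_closed A B) (setU_nonempty A B).

Lemma set_dist_subset a (C D : set X) : C !=set0 -> C `<=` D ->
  set_dist a D <= set_dist a C.
Proof.
move=> [c Cc] CD; apply: lb_le_inf; first by exists (mdist a c), c.
by move=> _ [d Cd <-]; apply: set_dist_le; exact: CD.
Qed.

Lemma hyperspaceU_mdist_le A B C :
  mdist (hyperspaceU A B) (hyperspaceU A C) <= mdist B C.
Proof.
wlog suff le_excess : B C /
    hausdorff_excess (A `|` B) (A `|` C) <= mdist B C.
  rewrite [leLHS]mdist_hyperspace ge_max le_excess /=.
  by rewrite mdist_hyperspace hausdorff_distC -mdist_hyperspace.
have [b Bb] := hyperspace_nonempty B.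
apply: hausdorff_excess_le; first by exists b; right.
move=> z [Az|Bz].
  by apply: le_trans (mdist_ge0 _ _); rewrite -(mdistxx z) set_dist_le //; left.
apply: le_trans (set_dist_subset z (hyperspace_nonempty C) (@subsetUr _ A C)) _.
apply: le_trans (set_dist_excess (hyperspace_nonempty C) Bz) _.
by rewrite mdist_hyperspace le_max lexx.
Qed.

Lemma hyperspaceU_continuous A : continuous (hyperspaceU A).
Proof.
by apply: nonexpansive_continuous => B C; exact: hyperspaceU_mdist_le.
Qed.

End hyperspace_continuity.

(** * Maximal chains of subcontinua through a point *)

Section order_arc.
Context {R : realType} {X : continuumType R}.
Implicit Types (x y z : X) (A B C : set X) (L D : set (set X)).

(** The last clause is maximality, stated as a membership test: comparability with all members
    suffices. *)
Definition order_arc y L :=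
  [/\ total_on L subset,
      forall A, L A -> [/\ closed A, connected A & A y] &
      forall B, closed B -> connected B -> B y ->
        (forall A, L A -> A `<=` B \/ B `<=` A) -> L B].

Lemma order_arc_exists y : exists L, order_arc y L.
Proof.
pose P L := total_on L subset /\
  forall A, L A -> [/\ closed A, connected A & A y].
have [F FP tF|L [[tL PL] maxL]] := @Zorn_bigcup (set X) P.
  split=> [A B [L FL LA] [K FK KB]|A [L /FP[_ +] LA]]; last exact.
  have [LK|KL] := tF _ _ FL FK.
  - by have [tK _] := FP _ FK; apply: tK => //; exact: LK.
  - by have [tL _] := FP _ FL; apply: tL => //; exact: KL.
exists L; split => // B cB coB By LB; apply: contrapT => nLB.
apply: (maxL (L `|` [set B])).
  by split=> [A|]; [left | move=> /(_ B (or_intror erefl))].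
split=> [A A' [LA|->] [LA'|->]|A [/PL//|->//]].
- exact: tL.
- exact: LB.
- by have [] := LB _ LA'; [right | left].
- by left.
Qed.

Section order_arc_theory.
Variables (y : X) (L : set (set X)).
Hypothesis arcL : order_arc y L.

Let totL : total_on L subset. Proof. by case: arcL. Qed.
Let closedL A : L A -> closed A.
Proof. by case: arcL => _ + _ => /[apply] -[]. Qed.
Let connectedL A : L A -> connected A.
Proof. by case: arcL => _ + _ => /[apply] -[]. Qed.
Let baseL A : L A -> A y. Proof. by case: arcL => _ + _ => /[apply] -[]. Qed.
Let maxL B : closed B -> connected B -> B y ->
  (forall A, L A -> A `<=` B \/ B `<=` A) -> L B.
Proof. by case: arcL => _ _; exact. Qed.

Lemma order_arc_set1 : L [set y].
Proof.
apply: maxL => //; [exact: closed_singleton | exact: connected1 |].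
by move=> A /baseL Ay; right => _ ->.
Qed.

Lemma order_arc_setT : L [set: X].
Proof.
by apply: maxL => //; [exact: continuum_connected | left].
Qed.

(** A member of [L] lies in some member of [D], or contains them all and, being closed, the closure
    of their union. *)
Lemma order_arc_bigcup D : D `<=` L -> D !=set0 ->
  L (closure (\bigcup_(A in D) A)).
Proof.
move=> DL [A0 DA0]; apply: maxL.
- exact: closed_closure.
- apply: connected_closure; apply: bigcup_connected.
    by exists y => A /DL/baseL.
  by move=> A /DL/connectedL.
- by apply: subset_closure; exists A0 => //; apply: baseL; exact: DL.
- move=> A LA; have [[B DB AB]|nD] := pselect (exists2 B, D B & A `<=` B).
    by left=> z Az; apply: subset_closure; exists B => //; exact: AB.
  right; rewrite [X in _ `<=` X](closure_id A).1; last exact: closedL.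
  apply: closureS => z [B DB Bz]; have [AB|] := totL LA (DL _ DB); last exact.
  by exfalso; apply: nD; exists B.
Qed.

Lemma order_arc_bigcap D : D `<=` L -> D !=set0 -> L (\bigcap_(A in D) A).
Proof.
move=> DL D0; apply: maxL.
- by apply: closed_bigI => A /DL/closedL.
- apply: (bigcap_chain_connected R (metric_hausdorff (T := X))
    (@continuum_compact R X)) => //.
  + by move=> A B /DL LA /DL LB; exact: totL.
  + by move=> A /DL/closedL.
  + by move=> A /DL/connectedL.
- by move=> A /DL/baseL.
- move=> A LA; have [[B DB BA]|nD] := pselect (exists2 B, D B & B `<=` A).
    by right=> z /(_ _ DB)/BA.
  left=> z Az B DB; have [AB|BA] := totL LA (DL _ DB); first exact: AB.
  by exfalso; apply: nD; exists B.
Qed.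

(** Boundary bumping would insert a subcontinuum strictly between [A] and [B]; it is comparable with
    all members, so maximality would put it in [L]. *)
Lemma order_arc_no_gap A B : L A -> L B -> A `<=` B ->
  (forall C, L C -> C `<=` A \/ B `<=` C) -> A = B.
Proof.
move=> LA LB AB gap; apply: contrapT => nAB.
have [||||||C [clC coC [AC nCA] [CB nBC]]] := @connected_closed_between R X
  (metric_hausdorff (T := X)) (@continuum_compact R X) A B.
- by exists y; exact: baseL.
- exact: closedL.
- exact: connectedL.
- exact: closedL.
- exact: connectedL.
- by split => // BA; apply: nAB; exact/seteqP.
suff /gap[] : L C by [].
apply: maxL => //; first by apply: AC; exact: baseL.
move=> E /gap[EA|BE]; [left|right].
- exact: subset_trans AC.
- exact: subset_trans BE.
Qed.

(** This closure and the intersection [Q] of the members through [x] bound a gap of [L], so they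
    coincide. Since [x] is not [y], the set [[set y]] is a member avoiding [x]. *)
Lemma order_arc_avoiding_closure x : x != y ->
  closure (\bigcup_(A in [set A | L A /\ ~ A x]) A) x.
Proof.
move=> xy; set S := closure _; pose Q := \bigcap_(A in [set A | L A /\ A x]) A.
suff -> : S = Q by move=> A [].
apply: order_arc_no_gap.
- apply: order_arc_bigcup => [A []//|]; exists [set y].
  by split; [exact: order_arc_set1 | move=> /= /eqP; exact/negP].
- apply: order_arc_bigcap => [A []//|]; exists setT.
  by split => //; exact: order_arc_setT.
- move=> z Sz A [LA Ax]; apply: (closedL LA); apply: closureS Sz.
  move=> w [B [LB nBx] Bw]; have [BA|AB] := totL LB LA; first exact: BA.
  by exfalso; exact/nBx/AB.
- move=> C LC; have [Cx|nCx] := pselect (C x); [right|left].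
    by move=> z; apply.
  by move=> z Cz; apply: subset_closure; exists C.
Qed.

(** * Parametrization of a maximal chain by a path *)

Section level.
Variable m : set X -> R.
Hypotheses (m_ge0 : forall A, 0 <= m A)
  (m_lt : forall A B, closed A -> A `<` B -> m A < m B).

Let sub_le A B : L A -> L B -> m A <= m B -> A `<=` B.
Proof.
move=> LA LB mAB; have [//|BA] := totL LA LB.
apply: contrapT => nAB; have := m_lt (closedL LB) (conj BA nAB).
by rewrite ltNge mAB.
Qed.

(** The disjunct for [[set y]] keeps the family nonempty when [t] is below all values of [m]. *)
Let low t : set (set X) := [set A | L A /\ (A = [set y] \/ m A <= t)].

(** As [m] may jump along [L], not every [t] is a value of [m]; [level] is constant over the omitted
    values. *)
Definition level (t : R) : set X := closure (\bigcup_(A in low t) A).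

Let low_set1 t : low t [set y].
Proof. by split; [exact: order_arc_set1 | left]. Qed.

Let levelL t : L (level t).
Proof.
by apply: order_arc_bigcup => [A []//|]; exists [set y]; exact: low_set1.
Qed.

Lemma level_subset s t : s <= t -> level s `<=` level t.
Proof.
move=> st; apply: closureS => z [A [LA +] Az] => As; exists A => //; split => //.
by case: As => [->|mAs]; [left | right; exact: le_trans st].
Qed.

Let level_sub t A : L A -> t <= m A -> level t `<=` A.
Proof.
move=> LA tA z lz; apply: (closedL LA); apply: closureS lz.
move=> w [B [LB [->|mB]] Bw]; first by rewrite Bw; exact: baseL.
exact: sub_le LB LA (le_trans mB tA) _ Bw.
Qed.

Let sub_level t A : L A -> m A <= t -> A `<=` level t.
Proof.
by move=> LA tA z Az; apply: subset_closure; exists A => //; split => //; right.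
Qed.

Lemma level_id A : L A -> level (m A) = A.
Proof.
by move=> LA; apply/seteqP; split; [exact: level_sub|exact: sub_level].
Qed.

Lemma level_lt0 t : t < 0 -> level t = [set y].
Proof.
move=> t0; apply/seteqP; split; last first.
  by move=> z ->; exact: baseL.
apply: level_sub; first exact: order_arc_set1.
exact: le_trans (ltW t0) (m_ge0 _).
Qed.

(** Members of value at least [t] contain [level t], so by the absence of gaps those of value below
    [t], with [[set y]], have a union dense in it. *)
Let level_left t z (e : R) : level t z -> 0 < e ->
  exists2 s, s < t & exists2 w, level s w & mdist z w < e.
Proof.
move=> tz e0.
pose D := [set A | L A /\ (A = [set y] \/ m A < t)].
have DL : D `<=` L by move=> A [].
have E : closure (\bigcup_(A in D) A) = level t.
  apply: order_arc_no_gap => //.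
  - by apply: order_arc_bigcup => //; exists [set y]; split;
      [exact: order_arc_set1 | left].
  - apply: closureS => w [A [LA +] Aw] => At; exists A => //; split => //.
    by case: At => [->|/ltW]; [left|right].
  - move=> C LC; have [Ct|tC] := ltP (m C) t; [left|right].
      move=> w Cw; apply: subset_closure; exists C => //; split => //.
      by right.
    exact: level_sub.
move: tz; rewrite -E => /(_ _ (nbhsx_ballx z e e0))[w [[A [LA At] Aw]]].
rewrite ballEmdist /= => zw; case: At => [Ay|At].
  (* Any earlier parameter would do, since every level contains [y]. *)
  by exists (t - 1); rewrite ?gtrBl //; exists w => //;
     move: Aw; rewrite Ay => ->; exact: baseL.
by exists (m A) => //; exists w => //; rewrite level_id.
Qed.

(** Dually, [level t] is the intersection of the members of value above [t]; the whole space is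
    added so that the family is nonempty. *)
Let level_right t z : ~ level t z -> exists2 s, t < s & ~ level s z.
Proof.
move=> ntz.
pose D := [set A | L A /\ (A = [set: X] \/ t < m A)].
have E : level t = \bigcap_(A in D) A.
  apply: order_arc_no_gap => //.
  - apply: order_arc_bigcap => [A []//|]; exists setT.
    by split; [exact: order_arc_setT | left].
  - by move=> w tw A [LA [->//|/ltW tA]]; exact: level_sub tw.
  - move=> C LC; have [Ct|tC] := leP (m C) t; [left|right].
      exact: sub_level.
    by move=> w; apply; split => //; right.
have [A [LA At] nAz] : exists2 A, D A & ~ A z.
  apply: contrapT => nD; apply: ntz; rewrite E => A DA.
  by apply: contrapT => nAz; apply: nD; exists A.
case: At => [AT|tA]; first by exfalso; apply: nAz; rewrite AT.
by exists (m A) => //; rewrite level_id.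
Qed.

Let level_nonempty t : level t !=set0.
Proof. by exists y; exact: baseL. Qed.

Definition hlevel t : hyperspace X :=
  Hyperspace (@closed_closure _ _ : closed (level t)) (level_nonempty t).

Lemma hlevel_continuous : continuous hlevel.
Proof.
apply: monotone_hyperspace_continuous.
- exact: level_subset.
- exact: level_left.
- exact: level_right.
Qed.

End level.

Lemma order_arc_path A : L A -> exists g : R -> hyperspace X,
  [/\ continuous g, g 0 = hsingleton y, g 1 = A :> set X &
      forall t, t <= 1 -> g t `<=` A].
Proof.
move=> LA.
have [m [m0 mlt]] := compact_strictly_monotone y (@continuum_compact R X).
(* [p] climbs from -1 to [m A] on the unit interval; the start is negative because the level there
   is [[set y]]. *)
pose p (t : R) := t * (m A + 1) - 1.
have pcont : continuous p.
  move=> t; apply: cvgB; last exact: cvg_cst.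
  by apply: cvgM; [exact: cvg_id | exact: cvg_cst].
have p1 : p 1 = m A by rewrite /p mul1r addrK.
exists (hlevel m \o p); split.
- move=> t; apply: continuous_comp; first exact: pcont.
  exact: hlevel_continuous mlt _.
- apply: hyperspace_inj; rewrite /= level_lt0 // /p mul0r sub0r.
  by rewrite oppr_lt0.
- by rewrite /= p1 level_id.
- move=> t t1; rewrite -[X in _ `<=` X](level_id mlt) // -p1.
  by apply: level_subset; rewrite lerB // ler_wpM2r // addr_ge0.
Qed.

End order_arc_theory.
End order_arc.

(** * Paths avoiding a point, and the blocked set *)

Lemma within_continuous_precomp {T U V : topologicalType} (A : set T)
    (B : set U) (f : T -> U) (g : U -> V) : continuous f ->
  (forall x, A x -> B (f x)) -> {within B, continuous g} ->
  {within A, continuous (g \o f)}.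
Proof.
move=> cf fAB cg; apply/continuous_closedP => W cW.
case/continuous_closedP/(_ _ cW)/closed_subspaceP : cg => S cS SW.
apply/closed_subspaceP; exists (f @^-1` S).
  by move/continuous_closedP : cf; exact.
apply/seteqP; split=> t [Wt At]; split => //.
- have : (S `&` B) (f t) by split => //; exact: fAB.
  by rewrite SW => -[].
- have : (g @^-1` W `&` B) (f t) by split => //; exact: fAB.
  by rewrite -SW => -[].
Qed.

(** The piece of a separation that contains [A] would have the other piece in its closure. *)
Lemma connected_between_closure {T : topologicalType} (A B : set T) :
  A `<=` B -> B `<=` closure A -> connected A -> connected B.
Proof.
move=> AB BA cA; apply/connectedP => E [E0 BE sE].
wlog AE : E E0 BE sE / A `<=` E false.
  move=> wl; have := connected_subset sE _ cA; rewrite -BE => /(_ AB)[|AE].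
    exact: wl.
  apply: (wl (E \o negb)) => //=; [by rewrite setUC | by rewrite separatedC].
have [z Ez] := E0 true; case: sE => sE _.
suff : set0 z by [].
rewrite -sE; split => //; apply: (closureS AE); apply: BA.
by rewrite BE; right.
Qed.

Section blocked_points.
Context {R : realType} {X : continuumType R}.
Implicit Types (x y z : X) (A : set X) (L : set (set X)).

Lemma blocked_points_base x : blocked_points x x.
Proof.
move=> [g [_ g0 _ gx]].
have : (g 0 `&` hsingleton x) x by rewrite g0.
by rewrite gx // lexx ltr01.
Qed.

Lemma does_not_block_order_arc x y z L A : order_arc y L -> L A -> ~ A x ->
  A z -> does_not_block (hsingleton x) (hsingleton z) ->
  does_not_block (hsingleton x) (hsingleton y).
Proof.
move=> arcL LA nAx Az.
have itv01 : `[0, 1]%classic =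
    `[0, 2^-1]%classic `|` `[2^-1, 1]%classic :> set R.
  apply/seteqP; split=> t; rewrite /= !in_itv /=.
    case: (leP t 2^-1) => ? /andP[? ?]; [left|right]; apply/andP; split; lra.
  by move=> [] /andP[? ?]; apply/andP; split; lra.
have half_le (t : R) : t <= 2^-1 -> 2 * t <= 1 by move=> ?; lra.
have half_lt (t : R) : 2^-1 < t -> t < 1 -> 0 <= 2 * t - 1 < 1.
  by move=> ? ?; apply/andP; split; lra.
move=> [k [k_cont k0 k1 k_x]].
have [g [g_cont g0 g1 gA]] := order_arc_path arcL LA.
(* First grow from [[set y]] to [A] at double speed, then unite [A], in the form [g 1], with the
   path [k] from [[set z]] to the whole space. *)
pose f t := g (2 * t).
pose h := hyperspaceU (g 1) \o (k \o (fun t => 2 * t - 1)).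
have f_cont : continuous f.
  move=> t; apply: continuous_comp; last exact: g_cont.
  by apply: cvgM; [exact: cvg_cst | exact: cvg_id].
have h_cont : {within `[2^-1, 1], continuous h}.
  apply: within_continuous_comp.
    by move=> B _; exact: hyperspaceU_continuous.
  apply: (within_continuous_precomp _ _ k_cont) => [t|t].
    apply: cvgB; last exact: cvg_cst.
    by apply: cvgM; [exact: cvg_cst | exact: cvg_id].
  by rewrite /= !in_itv /= => /andP[? ?]; apply/andP; split; lra.
(* The halves agree at 1/2 because [k 0] is [[set z]], already inside [A]. *)
have fh t : t = 2^-1 -> f t = h t.
  move=> ->; rewrite /f /h /= mulfV ?subrr ?pnatr_eq0 // k0; apply: hyperspace_inj.
  by rewrite /= g1; apply/esym/setUidPl => _ ->.
exists (fun t => if t <= 2^-1 then f t else h t); split.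
- rewrite itv01.
  apply: withinU_continuous; [exact: itv_closed|exact: itv_closed| |].
    apply: (subspace_eq_continuous (f := from_subspace _ f)).
      move=> t; rewrite inE /= in_itv /= => /andP[_ t2].
      by rewrite /from_subspace t2.
    exact: continuous_subspaceT.
  apply: (subspace_eq_continuous (f := from_subspace _ h)) => // t.
  rewrite inE /= in_itv /= => /andP[t1 _]; rewrite /from_subspace.
  case: ifPn => // t2.
  by apply/esym/fh/le_anti; rewrite t1 t2.
- by rewrite invr_ge0 ler0n /f mulr0.
- rewrite ifN -?ltNge ?invf_lt1 ?ltr1n // /h /= mulr1 -natr1 addrK k1.
  by apply: hyperspace_inj; rewrite /= setUT.
- move=> t /andP[t0 t1]; rewrite -subset0 => w [+ wx]; rewrite wx {w wx} => Hx.
  case: ifP Hx => [t2 /gA|/negbT t2 [|kx]].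
  + by move=> /(_ (half_le _ t2))/nAx.
  + by rewrite g1.
  + have : (k (2 * t - 1) `&` hsingleton x) x by [].
    by rewrite k_x // half_lt // ltNge.
Qed.

Lemma blocked_point_connected_to x y : blocked_points x y ->
  exists C, [/\ connected C, C `<=` blocked_points x, C x & C y].
Proof.
move=> xy; have [->|ynx] := eqVneq y x.
  exists [set x]; split => //; first exact: connected1.
  by move=> _ ->; exact: blocked_points_base.
have [L arcL] := order_arc_exists y.
pose S := \bigcup_(A in [set A | L A /\ ~ A x]) A.
have Sy : S y.
  exists [set y] => //; split; first exact: order_arc_set1.
  by move=> /= /eqP; rewrite eq_sym; exact/negP.
have [_ LP _] := arcL.
exists (S `|` [set x]); split; [| |by right|by left].
- apply: (@connected_between_closure _ S); first by move=> z; left.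
    move=> z [Sz|->]; first exact: subset_closure.
    by apply: (order_arc_avoiding_closure arcL); rewrite eq_sym.
  apply: bigcup_connected; first by exists y => A [/LP[]].
  by move=> A [/LP[]].
(* A path freeing [z] would yield one freeing [y], against [xy]. *)
- move=> z [[A [LA nAx] Az] zx|-> //]; last exact: blocked_points_base.
  exact/xy/(does_not_block_order_arc arcL LA nAx Az).
Qed.

End blocked_points.

Theorem theorem3p2 (R : realType) (X : continuumType R) (x : X) :
  connected (blocked_points x).
Proof.
(* The blocked set is a union of connected sets that share [x]. *)
pose D := [set C | [/\ connected C, C `<=` blocked_points x & C x]].
have -> : blocked_points x = \bigcup_(C in D) C.
  apply/seteqP; split=> [y|y [C [_ Cx _]]]; last exact: Cx.
  by move=> /blocked_point_connected_to[C [? ? ? ?]]; exists C.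
by apply: bigcup_connected => [|C []//]; exists x => C [].
Qed.
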